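(* Let $\Gamma$ be a group generated by a symmetric set $S$ of size $2d$, acting by isometries on a complete geodesic $p$-uniformly convex space $(Y,d_Y)$ with constant $c_Y$ ($p\ge2$). Let $X=\mathrm{Cay}(\Gamma,S)$, let $j$ be an even positive integer and let $\mu=\mu_X^j$ be the $j$-th convolution power of the standard random walk on $X$. Then there is a constant $C$ depending only on $p,c_Y,d,j$ such that for every $\Gamma$-equivariant $f:X\to Y$ and every integer $n\ge1$, $$\mathcal E^{(p)}_\mu\big(A^{(p)}_{\mu^n}f\big)\le C\Big(\sqrt{\tfrac{\log n}{n}}\;\mathcal E^{(p)}_{\mu^n}(f)+\tfrac1n\,\mathcal E^{(p)}_\mu(f)\Big).$$
   Context: $p$-uniform convexity with constant $c_Y>0$: for all $x,y,z\in Y$, every constant-speed geodesic $\gamma:[0,1]\to Y$ from $y$ to $z$ and $t\in[0,1]$, $d_Y(x,\gamma(t))^p\le(1-t)d_Y(x,y)^p+t\,d_Y(x,z)^p-c_Y^p t(1-t)d_Y(y,z)^p$. For a finitely supported probability measure $\sigma$ on $Y$, $c_p(\sigma)$ is the unique minimizer of $y\mapsto\int d_Y(u,y)^p d\sigma(u)$. $S=S^{-1}$, $1\notin S$. The Cayley graph $X$ has vertex set $\Gamma$ and edges $\{x,xs\}$, $s\in S$; $\Gamma$ acts on $X$ by left multiplication. The standard random walk is $\mu_X(x\to xs)=\frac1{2d}$ for $s\in S$; convolution powers $\eta^{n+1}(x\to x'')=\sum_{x'}\eta^n(x\to x')\eta(x'\to x'')$. For an equivariant random walk $\eta$ and equivariant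 $f$, the energy is $\mathcal E^{(p)}_\eta(f)=\frac12\sum_{x'\in X}\eta(x_0\to x')d_Y(f(x_0),f(x'))^p$ (independent of $x_0\in X$), and the averaging is $(A^{(p)}_\eta f)(x)=c_p(f_*\eta(x\to\cdot))$, where $f_*\eta(x\to\cdot)$ is the push-forward. *)

(* Defs.v *)
From HB Require Import structures.
From mathcomp Require Import all_boot all_order all_algebra.
From mathcomp Require Import all_classical all_reals all_analysis.
From Stdlib Require ClassicalEpsilon List.

Set Implicit Arguments.
Unset Strict Implicit.
Unset Printing Implicit Defensive.

Import Order.TTheory GRing.Theory Num.Theory.
Local Open Scope ring_scope.

Section Defs.
Variable R : realType.

Record is_group (G : Type) (mul : G -> G -> G) (inv : G -> G) (one : G) : Prop := {
  grp_assoc : forall x y z, mul x (mul y z) = mul (mul x y) z;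
  grp_mul1g : forall x, mul one x = x;
  grp_mulg1 : forall x, mul x one = x;
  grp_mulVg : forall x, mul (inv x) x = one;
  grp_mulgV : forall x, mul x (inv x) = one }.

Definition symmetric_set (G : Type) (inv : G -> G) (S : seq G) : Prop :=
  forall s, List.In s S -> List.In (inv s) S.

(* S generates G (as S is symmetric, positive words suffice) *)
Definition generates (G : Type) (mul : G -> G -> G) (one : G) (S : seq G) : Prop :=
  forall g, exists w : seq G, (forall s, List.In s w -> List.In s S) /\
                              g = foldr mul one w.

Record is_metric (Y : Type) (dY : Y -> Y -> R) : Prop := {
  met_ge0 : forall x y, 0 <= dY x y;
  met_eq0 : forall x y, dY x y = 0 <-> x = y;
  met_sym : forall x y, dY x y = dY y x;
  met_tri : forall x y z, dY x z <= dY x y + dY y z }.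

Definition complete_metric (Y : Type) (dY : Y -> Y -> R) : Prop :=
  forall u : nat -> Y,
    (forall e : R, 0 < e -> exists N : nat, forall m n : nat,
        (N <= m)%N -> (N <= n)%N -> dY (u m) (u n) < e) ->
    exists l : Y, forall e : R, 0 < e -> exists N : nat, forall n : nat,
        (N <= n)%N -> dY (u n) l < e.

Definition cs_geodesic (Y : Type) (dY : Y -> Y -> R) (gamma : R -> Y) (y z : Y) : Prop :=
  gamma 0 = y /\ gamma 1 = z /\
  forall s t : R, 0 <= s <= 1 -> 0 <= t <= 1 ->
    dY (gamma s) (gamma t) = `|s - t| * dY y z.

Definition geodesic_space (Y : Type) (dY : Y -> Y -> R) : Prop :=
  forall y z : Y, exists gamma : R -> Y, cs_geodesic dY gamma y z.

Definition p_uniformly_convex (p c : R) (Y : Type) (dY : Y -> Y -> R) : Prop :=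
  forall (x y z : Y) (gamma : R -> Y), cs_geodesic dY gamma y z ->
    forall t : R, 0 <= t <= 1 ->
      (dY x (gamma t)) `^ p <=
        (1 - t) * (dY x y) `^ p + t * (dY x z) `^ p
        - c `^ p * t * (1 - t) * (dY y z) `^ p.

Definition isometric_action (G Y : Type) (mul : G -> G -> G) (one : G)
    (dY : Y -> Y -> R) (act : G -> Y -> Y) : Prop :=
  (forall y, act one y = y) /\
  (forall g h y, act (mul g h) y = act g (act h y)) /\
  (forall g y y', dY (act g y) (act g y') = dY y y').

(* f : X -> Y is Gamma-equivariant (vertices of X = elements of G,
   G acting on X by left multiplication) *)
Definition equivariant (G Y : Type) (mul : G -> G -> G) (act : G -> Y -> Y)
    (f : G -> Y) : Prop :=
  forall g x, f (mul g x) = act g (f x).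

(* ---------- equivariant random walks on the Cayley graph ----------
   An equivariant random walk eta is determined by its transition law from
   the identity vertex 1; we represent it as a finite list of weighted atoms
   (w, g) so that eta(x -> x') = sum of the w over atoms (w, g) with x g = x'
   (equivalently eta(x -> x') = eta(1 -> x^{-1} x')). *)
Definition walk (G : Type) := seq (R * G).

Definition walk_kernel (G : Type) (mul : G -> G -> G) (eta : walk G)
    (x x' : G) : R :=
  \sum_(a <- eta | `[< mul x a.2 = x' >]) a.1.

Definition std_walk (G : Type) (d : nat) (S : seq G) : walk G :=
  [seq ((2 * d)%:R^-1, s) | s <- S].

Definition wconv (G : Type) (mul : G -> G -> G) (eta1 eta2 : walk G) : walk G :=
  [seq (a.1 * b.1, mul a.2 b.2) | a <- eta1, b <- eta2].

Definition wpow (G : Type) (mul : G -> G -> G) (one : G) (eta : walk G) (n : nat)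
    : walk G :=
  iter n (fun e => wconv mul e eta) [:: (1, one)].

Definition energy (p : R) (G Y : Type) (one : G) (dY : Y -> Y -> R)
    (eta : walk G) (f : G -> Y) : R :=
  2^-1 * \sum_(a <- eta) a.1 * (dY (f one) (f a.2)) `^ p.

(* p-barycenter c_p(sigma) of a finitely supported measure sigma on Y
   (given as weighted atoms): the minimizer of y |-> int d(u,y)^p dsigma(u).
   It is chosen by Hilbert's epsilon; y0 only witnesses that Y is inhabited. *)
Definition p_cost (p : R) (Y : Type) (dY : Y -> Y -> R) (sigma : seq (R * Y))
    (y : Y) : R :=
  \sum_(a <- sigma) a.1 * (dY a.2 y) `^ p.

Definition is_p_barycenter (p : R) (Y : Type) (dY : Y -> Y -> R)
    (sigma : seq (R * Y)) (y : Y) : Prop :=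
  forall z : Y, p_cost p dY sigma y <= p_cost p dY sigma z.

Definition c_p (p : R) (Y : Type) (dY : Y -> Y -> R) (y0 : Y)
    (sigma : seq (R * Y)) : Y :=
  ClassicalEpsilon.epsilon (inhabits y0) (is_p_barycenter p dY sigma).

Definition pushforward (G Y : Type) (mul : G -> G -> G) (eta : walk G)
    (f : G -> Y) (x : G) : seq (R * Y) :=
  [seq (a.1, f (mul x a.2)) | a <- eta].

Definition averaging (p : R) (G Y : Type) (mul : G -> G -> G)
    (dY : Y -> Y -> R) (eta : walk G) (f : G -> Y) : G -> Y :=
  fun x => c_p p dY (f x) (pushforward mul eta f x).

End Defs.

(* Main.v *)
(* Write T for the transition operator of mu, y = A f (1), F b = d (f b, y)^p.
   Uniform convexity gives the variational inequality
   c^p d (b, w)^p <= cost w - cost b for a p-barycenter b; summed over the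
   neighbours of 1, and since by equivariance the minimal cost does not depend on
   the vertex, it yields 2 c^p E_mu (A f) <= T^(n+1) F (1) - T^n F (1).
   As j is even, mu has an atom of mass e = (2d)^-j at 1, say mu = e delta_1 + nu,
   so T^n is the binomial mixture of the powers of T_nu. The binomial weights of
   n + 1 and n differ by a factor at most 1 + K sqrt (ln n / n), outside a set
   whose Chernoff bound O (n^-(p+1)) beats the growth O (k^p E_mu (f)) of the k-th
   term. Every atom of mu has mass e, so that growth follows from the triangle
   inequality alone. *)
Require Import Defs.
From HB Require Import structures.
From mathcomp Require Import all_boot all_order all_algebra.
From mathcomp Require Import all_classical all_reals all_analysis.
From mathcomp Require Import ring lra.
From Stdlib Require ClassicalEpsilon List.
Set Implicit Arguments.
Unset Strict Implicit.
Unset Printing Implicit Defensive.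
Import Order.TTheory GRing.Theory Num.Theory.
Local Open Scope ring_scope.

(** * Elementary inequalities for real powers *)

Section RealLemmas.
Variable R : realType.
Implicit Types a b e h p x y : R.

Lemma ler_powRl p a b : 0 <= p -> 0 <= a -> a <= b -> a `^ p <= b `^ p.
Proof.
by move=> p0 a0 ab; apply: ge0_ler_powR; rewrite // nnegrE // (le_trans a0 ab).
Qed.

Lemma powR_addr_le p a b : 0 <= p -> 0 <= a -> 0 <= b ->
  (a + b) `^ p <= 2 `^ p * (a `^ p + b `^ p).
Proof.
move=> p0 a0 b0.
wlog ab : a b a0 b0 / a <= b.
  move=> H; case: (leP a b) => [|/ltW] ab; first exact: H.
  by rewrite addrC [X in _ * X]addrC; exact: H.
apply: (@le_trans _ _ ((2 * b) `^ p)).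
  by apply: ler_powRl; [|lra|lra].
by rewrite powRM // ler_wpM2l ?powR_ge0 // lerDr powR_ge0.
Qed.

(** On [0, 1] powers decrease in the exponent, so it is enough to treat the integer exponent [q], by
    induction. *)
Lemma bernoulli_powR (q : nat) p x : p <= q%:R -> 1 <= p -> 0 <= x <= 1 ->
  1 - q%:R * (1 - x) <= x `^ p.
Proof.
move=> pq p1 /andP[x0 x1].
have [->|xn0] := eqVneq x 0.
  rewrite powR0; last by apply/eqP; lra.
  by lra.
have xgt0 : 0 < x by rewrite lt_neqAle eq_sym xn0.
apply: (@le_trans _ _ (x `^ q%:R)); last by apply: ger_powR; rewrite ?xgt0.
rewrite powR_mulrn //; elim: q {pq} => [|q IH]; first by rewrite expr0; lra.
rewrite exprSr -natr1.
have : 0 <= x ^+ q <= 1 by rewrite exprn_ge0 //= exprn_ile1.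
by move=> /andP[y0 y1]; nra.
Qed.

(** Bernoulli at x = b / a. The coefficient of [h] involves [a] alone, so for fixed [a] the bound is
    uniform in [b]; at a = 0 it vanishes by the convention 1/0 = 0. *)
Lemma powR_le_addr (q : nat) p a b h : p <= q%:R -> 1 <= p ->
  0 <= a -> 0 <= b -> 0 <= h -> a <= b + h ->
  a `^ p <= b `^ p + q%:R * a `^ p / a * h.
Proof.
move=> pq p1 a0 b0 h0 abh.
have [->|an0] := eqVneq a 0.
  rewrite powR0; last by apply/eqP; lra.
  by rewrite invr0 mulr0 mul0r addr0 powR_ge0.
have agt0 : 0 < a by rewrite lt_neqAle eq_sym an0.
have ap0 := powR_ge0 a p.
have [ab|/ltW ba] := leP a b.
  apply: ler_wpDr; last by apply: ler_powRl; lra.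
  by rewrite !mulr_ge0 ?invr_ge0.
have r01 : 0 <= b / a <= 1 by rewrite divr_ge0 //= ler_pdivrMr // mul1r.
have := bernoulli_powR pq p1 r01.
move=> /(ler_wpM2l ap0).
rewrite -powRM //; last by case/andP: r01.
rewrite mulrCA divff // mulr1 => H.
have : a - b <= h by lra.
have K0 : 0 <= q%:R * a `^ p / a by rewrite !mulr_ge0 ?invr_ge0.
move=> /(ler_wpM2l K0).
have E : a `^ p * (1 - q%:R * (1 - b / a)) =
  a `^ p - q%:R * a `^ p / a * (a - b) by field.
by rewrite E in H; lra.
Qed.

(** * Binomial sums and the lower tail of the binomial distribution *)

Lemma sum_binomial_recr (e : R) (n : nat) (c : nat -> R) :
  \sum_(k < n.+1) 'C(n, k)%:R * e ^+ (n - k) * (e * c k + c k.+1) =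
  \sum_(k < n.+2) 'C(n.+1, k)%:R * e ^+ (n.+1 - k) * c k.
Proof.
rewrite [RHS]big_ord_recl /= bin0 mul1r subn0.
under [in RHS]eq_bigr => k _ do rewrite /bump /= add1n binS natrD !mulrDl subSS.
rewrite big_split /= addrA.
under eq_bigr => k _ do rewrite mulrDr.
rewrite big_split /=; congr (_ + _).
rewrite big_ord_recl /= bin0 mul1r subn0 mulrA -exprSr; congr (_ + _).
rewrite [RHS]big_ord_recr /= bin_small // !mul0r addr0.
apply: eq_bigr => k _; rewrite /bump /= add1n mulrA -!(mulrA _ _ e) -exprSr.
by rewrite subnSK.
Qed.

(** The probability that fewer than [t] of [N] independent steps are lazy, each being lazy with
    probability [e]; [k] counts the other steps. *)
Definition binomial_lower_tail (e : R) (N : nat) (t : R) : R :=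
  \sum_(k < N.+1 | (N - k)%:R < t) 'C(N, k)%:R * e ^+ (N - k) * (1 - e) ^+ k.

(** Exponential Markov inequality: on the tail exp (l (t - (N - k))) >= 1, and the binomial theorem
    sums the terms weighted by this factor. *)
Lemma binomial_chernoff (e l t : R) (N : nat) : 0 <= e <= 1 -> 0 <= l ->
  binomial_lower_tail e N t <=
  expR (l * t) * (1 - e + e * expR (- l)) ^+ N.
Proof.
move=> /andP[e0 e1] l0.
rewrite (addrC (1 - e)) exprDn mulr_sumr /binomial_lower_tail.
rewrite big_mkcond /=; apply: ler_sum => k _.
have w0 : 0 <= 'C(N, k)%:R * e ^+ (N - k) * (1 - e) ^+ k.
  by rewrite !mulr_ge0 ?exprn_ge0 // subr_ge0.
suff H : (N - k)%:R < t -> 1 <= expR (l * t) * expR (- l) ^+ (N - k).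
  rewrite exprMn -[X in expR (l * t) * X]mulr_natr.
  have -> : expR (l * t) *
     (e ^+ (N - k) * expR (- l) ^+ (N - k) * (1 - e) ^+ k * 'C(N, k)%:R) =
     ('C(N, k)%:R * e ^+ (N - k) * (1 - e) ^+ k) *
     (expR (l * t) * expR (- l) ^+ (N - k)) by ring.
  case: ifP => [/H|_]; first exact: ler_peMr.
  by rewrite mulr_ge0 // mulr_ge0 ?exprn_ge0 ?expR_ge0.
move=> kt; rewrite -expRM_natr -expRD -[leLHS]expR0 ler_expR.
by rewrite mulNr -mulrBr mulr_ge0 // subr_ge0 ltW.
Qed.

Lemma expRN_le (l : R) : 0 <= l -> expR (- l) <= 1 - l + l ^+ 2.
Proof.
move=> l0; rewrite expRN.
apply: (@le_trans _ _ (1 + l)^-1).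
  by rewrite lef_pV2 ?posrE ?expR_gt0 ?expR_ge1Dx //; lra.
rewrite -[leLHS]mul1r ler_pdivrMr; last by lra.
suff -> : (1 - l + l ^+ 2) * (1 + l) = 1 + l ^+ 3 by rewrite lerDl exprn_ge0.
by ring.
Qed.

(** With eta = dl / (1 + dl) the threshold is N e (1 - eta), and the Chernoff exponent is at most N
    e (l^2 - l eta), which is minimal at l = eta / 2. *)
Lemma binomial_lower_tail_gaussian (e dl : R) (N : nat) : 0 <= e <= 1 -> 0 <= dl ->
  binomial_lower_tail e N (N%:R * e / (1 + dl)) <=
  expR (- (N%:R * e * (dl / (1 + dl)) ^+ 2 / 4)).
Proof.
move=> e01 d0; case/andP: (e01) => e0 e1.
have d1 : 0 < 1 + dl by lra.
set eta := dl / (1 + dl).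
have eta0 : 0 <= eta by rewrite divr_ge0 // ltW.
have l0 : 0 <= eta / 2 by lra.
apply: le_trans (binomial_chernoff _ _ e01 l0) _.
apply: (@le_trans _ _ (expR (eta / 2 * (N%:R * e / (1 + dl))) *
  expR (e * (- (eta / 2) + (eta / 2) ^+ 2)) ^+ N)).
  rewrite ler_wpM2l ?expR_ge0 // lerXn2r ?nnegrE ?expR_ge0 //.
    by rewrite addr_ge0 ?mulr_ge0 ?expR_ge0 ?subr_ge0.
  apply: le_trans (expR_ge1Dx _).
  have := ler_wpM2l e0 (expRN_le l0); lra.
rewrite -expRM_natr -expRD ler_expR le_eqVlt; apply/orP; left; apply/eqP.
have -> : N%:R * e / (1 + dl) = N%:R * e * (1 - eta).
  by rewrite /eta; field; rewrite gt_eqF.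
by field.
Qed.

(** Write exp x as the (A + 1)-st power of exp (x / (A + 1)) >= x / (A + 1). *)
Lemma expRN_mul_exprn_le (x : R) (A : nat) : 0 <= x ->
  expR (- x) * x ^+ A.+1 <= A.+1%:R ^+ A.+1.
Proof.
move=> x0; rewrite expRN mulrC ler_pdivrMr ?expR_gt0 //.
have h : x / A.+1%:R <= expR (x / A.+1%:R).
  by apply: le_trans (expR_ge1Dx _); rewrite lerDr.
have -> : x = x / A.+1%:R * A.+1%:R by rewrite divfK // pnatr_eq0.
rewrite expRM_natr exprMn mulrC ler_wpM2l ?exprn_ge0 //.
by rewrite lerXn2r ?nnegrE ?expR_ge0 ?divr_ge0.
Qed.

Lemma binomial_lower_tail_poly (e : R) (A : nat) : 0 < e <= 1 ->
  exists K C : R, [/\ 0 <= K, 0 <= C & forall n : nat, (1 <= n)%N ->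
    binomial_lower_tail e n.+1
      (n.+1%:R * e / (1 + K * Num.sqrt (ln n%:R / n%:R))) * n.+1%:R ^+ A.+1 <= C].
Proof.
move=> /andP[e0 e1].
(* The 16 is 4 from the Gaussian exponent times 4 from dl / (1 + dl) >= dl / 2; it makes the
   exponent at least (A + 1) ln n when dl <= 1. *)
pose K := Num.sqrt (16 * A.+1%:R / e).
have K2 : K ^+ 2 = 16 * A.+1%:R / e by rewrite sqr_sqrtr // divr_ge0 // ltW.
exists K, (2 ^+ A.+1 + (16 / e) ^+ A.+1 * A.+1%:R ^+ A.+1).
have C0 : 0 <= (16 / e) ^+ A.+1 * A.+1%:R ^+ A.+1 :> R.
  by rewrite mulr_ge0 ?exprn_ge0 // divr_ge0 // ltW.
split; first exact: sqrtr_ge0.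
  by rewrite addr_ge0 // exprn_ge0.
move=> n n1.
have nR : 1 <= n%:R :> R by rewrite ler1n.
have ln0 : 0 <= ln n%:R :> R by apply: ln_ge0.
set dl := K * _.
have dl0 : 0 <= dl by rewrite mulr_ge0 ?sqrtr_ge0.
have dl2 : dl ^+ 2 = 16 * A.+1%:R / e * (ln n%:R / n%:R).
  by rewrite exprMn K2 sqr_sqrtr // divr_ge0.
have e01 : 0 <= e <= 1 by rewrite ltW.
have N0 : 0 <= n.+1%:R ^+ A.+1 :> R by rewrite exprn_ge0.
apply: le_trans (ler_wpM2r N0 (binomial_lower_tail_gaussian _ e01 dl0)) _.
have Nn : n.+1%:R = n%:R + 1 :> R by rewrite natr1.
(* For dl <= 1 the tail is at most n^-(A+1), and n + 1 <= 2 n gives the summand 2^(A+1). For dl > 1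
   the ratio dl / (1 + dl) exceeds 1/2, so the tail decays exponentially in n. *)
have [d1|d1] := leP dl 1.
  apply: ler_wpDr => //.
  apply: (@le_trans _ _ (expR (- ln n%:R * A.+1%:R) * (2 * n%:R) ^+ A.+1)).
    apply: ler_pM; rewrite ?expR_ge0 //.
      rewrite ler_expR mulNr lerN2.
      have h : (dl / 2) ^+ 2 <= (dl / (1 + dl)) ^+ 2.
        rewrite lerXn2r ?nnegrE ?divr_ge0 //; try lra.
        by rewrite ler_wpM2l // lef_pV2 ?posrE; lra.
      have Ne : 0 <= n.+1%:R * e by rewrite mulr_ge0 // ltW.
      have := ler_wpM2l Ne h; rewrite exprMn dl2.
      have -> : n.+1%:R * e * (16 * A.+1%:R / e * (ln n%:R / n%:R) * 2^-1 ^+ 2) =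
         4 * (n.+1%:R / n%:R) * (ln n%:R * A.+1%:R).
        by field; rewrite !gt_eqF //; lra.
      have : 1 <= n.+1%:R / n%:R :> R by rewrite ler_pdivlMr; lra.
      have : 0 <= ln n%:R * A.+1%:R :> R by rewrite mulr_ge0.
      set X := ln _ * _; set Y := _ / n%:R; set Z := _ ^+ 2.
      by move=> X0 Y1; nra.
    by rewrite lerXn2r ?nnegrE ?mulr_ge0 //; lra.
  rewrite expRM_natr -exprMn expRN lnK; last by rewrite posrE; lra.
  by rewrite mulrCA mulVf ?mulr1 // gt_eqF //; lra.
apply: ler_wpDl; first by rewrite exprn_ge0.
set x := n.+1%:R * e / 16.
have x0 : 0 <= x by rewrite /x !mulr_ge0 // ltW.
apply: (@le_trans _ _ (expR (- x) * n.+1%:R ^+ A.+1)).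
  rewrite ler_wpM2r // ler_expR lerN2.
  have : 2^-1 ^+ 2 <= (dl / (1 + dl)) ^+ 2.
    rewrite lerXn2r ?nnegrE ?divr_ge0 //; try lra.
    by rewrite ler_pdivlMr; lra.
  by rewrite /x; move: x0; rewrite /x; nra.
have -> : n.+1%:R = 16 / e * x by rewrite /x; field; rewrite gt_eqF.
rewrite exprMn mulrCA ler_wpM2l ?exprn_ge0 ?divr_ge0 //; first lra.
exact: expRN_mul_exprn_le.
Qed.

(* Passing from n to n + 1 multiplies the weight of k by e (n + 1) / (n + 1 - k),
   which is at most 1 + dl unless n + 1 - k lies in the lower tail. *)
Lemma binomial_step (e dl M : R) (n : nat) (c : nat -> R) : 0 < e <= 1 ->
  0 <= dl -> (forall k, 0 <= c k) ->
  (forall k, (k <= n.+1)%N -> c k <= (1 - e) ^+ k * M) ->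
  \sum_(k < n.+2) 'C(n.+1, k)%:R * e ^+ (n.+1 - k) * c k <=
  (1 + dl) * \sum_(k < n.+1) 'C(n, k)%:R * e ^+ (n - k) * c k +
  binomial_lower_tail e n.+1 (n.+1%:R * e / (1 + dl)) * M.
Proof.
move=> /andP[e0 e1] dl0 c0 cM; have e0' := ltW e0.
set t := _ / _.
rewrite (bigID (fun k : 'I_n.+2 => (n.+1 - k)%:R < t)) /= addrC.
apply: lerD; last first.
  rewrite mulr_suml; apply: ler_sum => k _.
  by rewrite -[leRHS]mulrA ler_wpM2l ?mulr_ge0 ?exprn_ge0 // cM // -ltnS.
rewrite mulr_sumr big_mkcond /= big_ord_recr /= subnn.
(* The term k = n + 1 has no counterpart in the sum for [n]; as t > 0 it belongs to the tail. *)
have t0 : 0 < t by rewrite /t divr_gt0 ?mulr_gt0 //; lra.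
rewrite t0 /= addr0; apply: ler_sum => k _.
have kn : (k <= n)%N by rewrite -ltnS.
case: ifP => [|_]; last by rewrite !mulr_ge0 ?exprn_ge0 //; lra.
rewrite -leNgt /t ler_pdivrMr; last by lra.
move=> good; rewrite !mulrA ler_wpM2r //.
have m0 : 0 < (n.+1 - k)%:R :> R by rewrite ltr0n subn_gt0.
rewrite -(ler_pM2l m0) !mulrA -natrM -(mul_bin_down n.+1 k) /= natrM.
rewrite subSn // exprS.
have := ler_wpM2r (_ : 0 <= 'C(n, k)%:R * e ^+ (n - k)) good.
rewrite subSn // => /(_ (mulr_ge0 _ _)) H.
apply: le_trans (le_trans (H _ _) _); rewrite ?exprn_ge0 // le_eqVlt; apply/orP; left; apply/eqP; ring.
Qed.
End RealLemmas.

(** * Sums over lists, with hypotheses on the members only *)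

Section WeightedSums.
Variables (R : realType) (T : Type).
Implicit Types s : seq T.

Lemma ler_sum_In s (F H : T -> R) : (forall a, List.In a s -> F a <= H a) ->
  \sum_(a <- s) F a <= \sum_(a <- s) H a.
Proof.
elim: s => [|a s IH] FH; first by rewrite !big_nil.
rewrite !big_cons lerD //; first by apply: FH; left.
by apply: IH => b bs; apply: FH; right.
Qed.

Lemma sumr_ge0_In s (F : T -> R) : (forall a, List.In a s -> 0 <= F a) ->
  0 <= \sum_(a <- s) F a.
Proof.
by move=> F0; apply: le_trans (ler_sum_In F0); rewrite big1.
Qed.

Lemma ler_term_sum_In s (F : T -> R) a : (forall b, List.In b s -> 0 <= F b) ->
  List.In a s -> F a <= \sum_(b <- s) F b.
Proof.
elim: s => //= b s IH F0; rewrite big_cons => -[<-|as_].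
  by rewrite lerDl; apply: sumr_ge0_In => c cs; apply: F0; right.
apply: ler_wpDl; first by apply: F0; left.
by apply: IH => // c cs; apply: F0; right.
Qed.
End WeightedSums.

(** * Transition operators of walks and their powers *)

Section Transition.
Variables (R : realType) (G : Type) (mul : G -> G -> G) (one : G).
Hypotheses (mulA : forall x y z, mul x (mul y z) = mul (mul x y) z)
  (mulg1 : forall x, mul x one = x).
Implicit Types (eta nu : walk R G) (F : G -> R).

Definition transition eta F : G -> R :=
  fun x => \sum_(a <- eta) a.1 * F (mul x a.2).

Definition mass eta : R := \sum_(a <- eta) a.1.

Definition nonneg_walk eta : Prop := forall a, List.In a eta -> 0 <= a.1.

Lemma transition_cst eta (c : R) x : transition eta (fun=> c) x = mass eta * c.
Proof. by rewrite /transition /mass mulr_suml. Qed.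

Lemma transition_conv eta1 eta2 F :
  transition (wconv mul eta1 eta2) F = transition eta1 (transition eta2 F).
Proof.
apply/funext => x; rewrite /transition /wconv big_allpairs_dep; apply: eq_bigr => a _.
by rewrite mulr_sumr; apply: eq_bigr => b _ /=; rewrite mulA mulrA.
Qed.

Lemma transition_pow eta n F :
  transition (wpow mul one eta n) F = iter n (transition eta) F.
Proof.
elim: n F => [|n IH] F.
  by apply/funext => x; rewrite /transition /= big_seq1 mul1r mulg1.
by rewrite [wpow _ _ _ _]/= transition_conv IH -iterSr.
Qed.

Lemma mass_conv eta1 eta2 : mass (wconv mul eta1 eta2) = mass eta1 * mass eta2.
Proof.
rewrite /mass /wconv big_allpairs_dep mulr_suml.
by apply: eq_bigr => a _; rewrite mulr_sumr.
Qed.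

Lemma mass_pow eta n : mass (wpow mul one eta n) = mass eta ^+ n.
Proof.
elim: n => [|n IH]; first by rewrite /mass /= big_seq1.
by rewrite [wpow _ _ _ _]/= mass_conv IH exprSr.
Qed.

Lemma in_wconv eta1 eta2 c : List.In c (wconv mul eta1 eta2) <->
  exists a b, [/\ List.In a eta1, List.In b eta2 & c = (a.1 * b.1, mul a.2 b.2)].
Proof.
rewrite /wconv; elim: eta1 => [|a eta1 IH] /=.
  by split=> // -[a [b []]].
split=> [/List.in_app_iff[/List.in_map_iff[b [<- bi]]|/IH[a' [b []]]]|].
- by exists a, b; split=> //; left.
- by move=> ai bi ->; exists a', b; split=> //; right.
- move=> [a' [b [ai bi cE]]]; apply/List.in_app_iff.
  case: ai => [aE|ai]; [left|right].
    by apply/List.in_map_iff; exists b; rewrite cE aE.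
  by apply/IH; exists a', b.
Qed.

Lemma nonneg_pow eta n : nonneg_walk eta -> nonneg_walk (wpow mul one eta n).
Proof.
move=> eta0; elim: n => [|n IH] a /=; first by case=> [<-|//].
by move=> /in_wconv[b [c [/IH b0 /eta0 c0 ->]]]; apply: mulr_ge0.
Qed.

Lemma pow_const_weight eta (w : R) n : (forall a, List.In a eta -> a.1 = w) ->
  forall a, List.In a (wpow mul one eta n) -> a.1 = w ^+ n.
Proof.
move=> etaw; elim: n => [|n IH] a /=; first by case=> [<-|//].
by move=> /in_wconv[b [c [/IH b0 /etaw c0 ->]]] /=; rewrite b0 c0 exprSr.
Qed.

Lemma le_transition eta F H x : nonneg_walk eta -> (forall y, F y <= H y) ->
  transition eta F x <= transition eta H x.
Proof.
by move=> eta0 FH; apply: ler_sum_In => a /eta0 a0; apply: ler_wpM2l.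
Qed.

Lemma iter_transition_ge0 eta F n x : nonneg_walk eta -> (forall y, 0 <= F y) ->
  0 <= iter n (transition eta) F x.
Proof.
move=> eta0 F0; elim: n x => [|n IH] x //=.
apply: (@le_trans _ _ (transition eta (fun=> 0) x)); last exact: le_transition.
by rewrite transition_cst mulr0.
Qed.

Lemma iter_transitionD eta (e : R) F H n x :
  iter n (transition eta) (fun y => e * F y + H y) x =
  e * iter n (transition eta) F x + iter n (transition eta) H x.
Proof.
elim: n x => [|n IH] x //=; rewrite /transition mulr_sumr -big_split /=.
by apply: eq_bigr => a _; rewrite IH mulrDr mulrCA.
Qed.

Lemma transition_lazy eta1 eta2 (e : R) F :
  transition (eta1 ++ (e, one) :: eta2) F =
  (fun x => e * F x + transition (eta1 ++ eta2) F x).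
Proof.
apply/funext => x; rewrite /transition !big_cat big_cons /= mulg1.
by rewrite addrCA.
Qed.

(** The operator is e times the identity plus the transition operator of the remaining atoms. These
    commute, so this is the binomial theorem, with Pascal's rule in [sum_binomial_recr]. *)
Lemma iter_transition_lazy eta1 eta2 (e : R) n F x :
  iter n (transition (eta1 ++ (e, one) :: eta2)) F x =
  \sum_(k < n.+1) 'C(n, k)%:R * e ^+ (n - k) *
     iter k (transition (eta1 ++ eta2)) F x.
Proof.
elim: n F => [|n IH] F.
  by rewrite big_ord_recl big_ord0 /= bin0 subnn expr0 !mul1r addr0.
rewrite iterSr IH transition_lazy.
rewrite -(sum_binomial_recr e n (fun k => iter k (transition (eta1 ++ eta2)) F x)).
by apply: eq_bigr => k _; rewrite iter_transitionD -iterSr.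
Qed.

(** A walk with steps of length at most [L] stays within k L of its start for k steps, so only the
    bound on [F] over that ball enters. It will be applied to the pseudo-distance pulled back from
    [Y] by [f]. *)
Lemma iter_transition_le (dist : G -> G -> R) (L M : R) eta k F x :
  (forall x y z, dist x z <= dist x y + dist y z) ->
  (forall x, dist x x = 0) ->
  (forall a x, List.In a eta -> dist x (mul x a.2) <= L) ->
  nonneg_walk eta -> 0 <= M ->
  (forall y, dist x y <= k%:R * L -> F y <= M) ->
  iter k (transition eta) F x <= mass eta ^+ k * M.
Proof.
move=> tri dist0 step eta0 M0; elim: k x => [|k IH] x FM /=.
  by rewrite expr0 mul1r; apply: FM; rewrite dist0 mul0r.
rewrite exprS -mulrA /mass mulr_suml; apply: ler_sum_In => a ai.
apply: ler_wpM2l; first exact: eta0.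
apply: IH => y dy; apply: FM; apply: le_trans (tri _ (mul x a.2) _) _.
by rewrite -natr1 mulrDl mul1r addrC lerD // step.
Qed.

(** Go along [s] and back along [t], [i] times: this is where the parity of [j] enters. *)
Lemma in_pow_double eta (w : R) (s t : G) i : List.In (w, s) eta ->
  List.In (w, t) eta -> mul s t = one ->
  List.In (w ^+ i.*2, one) (wpow mul one eta i.*2).
Proof.
move=> si ti st; elim: i => [|i IH] /=; first by left.
apply/in_wconv; exists (w ^+ i.*2 * w, mul one s), (w, t); split=> //.
  by apply/in_wconv; exists (w ^+ i.*2, one), (w, s).
by rewrite /= -mulA st mulg1 !exprSr.
Qed.
End Transition.

(** * Existence of p-barycenters and their variational inequality *)

Section Barycenter.
Variables (R : realType) (p c : R) (Y : Type) (dY : Y -> Y -> R).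
Hypotheses (p1 : 1 <= p) (c0 : 0 < c) (dYm : is_metric dY)
  (dYc : complete_metric dY) (dYg : geodesic_space dY)
  (dYu : p_uniformly_convex p c dY).
Variable sigma : seq (R * Y).
Hypotheses (sigma0 : forall a, List.In a sigma -> 0 <= a.1)
  (sigma1 : \sum_(a <- sigma) a.1 = 1).

Local Notation cost := (p_cost p dY sigma).

Lemma p_cost_ge0 y : 0 <= cost y.
Proof.
by apply: sumr_ge0_In => a /sigma0 a0; rewrite mulr_ge0 // powR_ge0.
Qed.

Lemma p_cost_convex gamma y z t : cs_geodesic dY gamma y z -> 0 <= t <= 1 ->
  cost (gamma t) <=
  (1 - t) * cost y + t * cost z - c `^ p * t * (1 - t) * dY y z `^ p.
Proof.
move=> gyz t01.
set D := _ * dY y z `^ p.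
have -> : D = \sum_(a <- sigma) a.1 * D by rewrite -mulr_suml sigma1 mul1r.
rewrite !mulr_sumr -big_split -sumrB /=.
apply: ler_sum_In => a /sigma0 a0.
apply: le_trans (ler_wpM2l a0 (dYu a.2 gyz t01)) _.
by rewrite -/D le_eqVlt; apply/orP; left; apply/eqP; ring.
Qed.

(** Compare [b] with the point at time t on a geodesic from [b] to [w], divide by t and let t tend
    to 0. *)
Lemma p_barycenter_variational b w : is_p_barycenter p dY sigma b ->
  c `^ p * dY b w `^ p <= cost w - cost b.
Proof.
move=> bmin; have [gamma gbw] := dYg b w.
set D := c `^ p * _.
have D0 : 0 <= D by rewrite mulr_ge0 ?powR_ge0.
apply/ler_addgt0Pr => e e0.
(* An explicit time in (0, 1] with t D <= e replaces the limit. *)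
set t := e / (D + 1 + e).
have den : 0 < D + 1 + e by lra.
have t0 : 0 < t by rewrite divr_gt0.
have t1 : t <= 1 by rewrite ler_pdivrMr // mul1r; lra.
have tD : t * D <= e.
  by rewrite /t mulrAC ler_pdivrMr // ler_wpM2l ?ltW //; lra.
have t01 : 0 <= t <= 1 by rewrite ltW.
have := le_trans (bmin (gamma t)) (p_cost_convex gbw t01).
have -> : c `^ p * t * (1 - t) * dY b w `^ p = t * (1 - t) * D.
  by rewrite /D; ring.
move=> H.
have : t * ((1 - t) * D) <= t * (cost w - cost b) by lra.
by rewrite ler_pM2l //; lra.
Qed.

(** [K] depends on [l] but not on [u], so the cost at the limit of a minimizing sequence is
    controlled. *)
Lemma p_cost_almost_lsc l : exists K : R, 0 <= K /\
  forall u, cost l <= cost u + K * dY u l.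
Proof.
pose q := Num.bound p.
have p0 : 0 <= p := le_trans ler01 p1.
have pq : p <= q%:R by exact/ltW/archi_boundP.
pose k (a : R * Y) := q%:R * dY a.2 l `^ p / dY a.2 l.
have k0 a : 0 <= k a.
  by rewrite /k !mulr_ge0 ?powR_ge0 // invr_ge0 (met_ge0 dYm).
exists (\sum_(a <- sigma) a.1 * k a); split.
  by apply: sumr_ge0_In => a /sigma0 a0; rewrite mulr_ge0.
move=> u; rewrite mulr_suml -big_split /=.
apply: ler_sum_In => a /sigma0 a0.
rewrite -mulrA -mulrDr ler_wpM2l //.
by apply: powR_le_addr => //; rewrite ?(met_ge0 dYm) // (met_tri dYm).
Qed.

(** Uniform convexity at midpoints makes any minimizing sequence Cauchy; by completeness it
    converges, and its limit is a minimizer. *)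
Lemma p_barycenter_exists : inhabited Y -> exists b, is_p_barycenter p dY sigma b.
Proof.
move=> [y0].
have p0 : 0 <= p := le_trans ler01 p1.
pose E := range cost.
have Elb : has_lbound E by exists 0 => _ [y _ <-]; exact: p_cost_ge0.
have Einf : has_inf E by split=> //; exists (cost y0), y0.
have infle y : inf E <= cost y by apply: ge_inf => //; exists y.
have [u uP] : {u : nat -> Y & forall n, cost (u n) < inf E + n.+1%:R^-1}.
  apply: (@choice _ _ (fun n y => cost y < inf E + n.+1%:R^-1)) => n.
  have [|_ [y _ <-] yP] := @inf_adherent _ E n.+1%:R^-1 _ Einf; first by [].
  by exists y.
have cp0 : 0 < c `^ p by rewrite powR_gt0.
have uCauchy : forall e : R, 0 < e -> exists N : nat, forall m n : nat,
    (N <= m)%N -> (N <= n)%N -> dY (u m) (u n) < e.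
  (* [x] is the midpoint gain for two points at distance [e]: if both costs are below inf + x and
     the distance is at least [e], the midpoint has cost below the infimum. *)
  move=> e e0; pose x := c `^ p * e `^ p / 4.
  have x0 : 0 < x by rewrite divr_gt0 // mulr_gt0 // powR_gt0.
  exists (Num.bound x^-1) => m n Nm Nn; rewrite ltNge; apply/negP => ed.
  have small k : (Num.bound x^-1 <= k)%N -> cost (u k) < inf E + x.
    move=> Nk; apply: lt_trans (uP k) _; rewrite ltrD2l invf_plt ?posrE //.
    apply: lt_le_trans (archi_boundP _) _; first by rewrite invr_ge0 ltW.
    by rewrite ler_nat ltnW.
  have [gamma g] := dYg (u m) (u n).
  have h01 : 0 <= (2^-1 : R) <= 1 by apply/andP; split; lra.
  have := le_trans (infle (gamma 2^-1)) (p_cost_convex g h01).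
  have := small _ Nm; have := small _ Nn.
  have ep : e `^ p <= dY (u m) (u n) `^ p by apply: ler_powRl => //; exact: ltW.
  have := ler_wpM2l (ltW cp0) ep; rewrite /x; lra.
have [l lP] := dYc uCauchy.
have [K [K0 KP]] := p_cost_almost_lsc l.
exists l => z; apply: le_trans (infle z).
apply/ler_addgt0Pr => e e0.
(* K + 1 is used as a divisor because [K] may be 0. *)
have e2 : 0 < e / (2 * (K + 1)) by rewrite divr_gt0 // mulr_gt0 //; lra.
have [N NP] := lP _ e2.
pose k := maxn N (Num.bound (2 / e)).
have ke : k.+1%:R^-1 < e / 2.
  rewrite invf_plt ?posrE ?divr_gt0 // invf_div.
  apply: lt_le_trans (archi_boundP _) _; first by rewrite divr_ge0 // ltW.
  by rewrite ler_nat (leq_trans (leq_maxr N _)).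
have Kd : K * dY (u k) l <= e / 2.
  apply: (@le_trans _ _ ((K + 1) * (e / (2 * (K + 1))))).
    apply: ler_pM; rewrite ?(met_ge0 dYm) ?lerDl //.
    by rewrite ltW // NP // leq_maxl.
  by rewrite le_eqVlt; apply/orP; left; apply/eqP; field; rewrite gt_eqF //; lra.
apply: le_trans (KP (u k)) _; apply: le_trans (lerD (ltW (uP k)) Kd) _.
by rewrite -addrA lerD2l [leRHS]splitr lerD2r ltW.
Qed.
End Barycenter.

(** * Averages of equivariant maps *)

Section EquivariantAveraging.
Variables (R : realType) (p c : R) (G : Type) (mul : G -> G -> G)
  (inv : G -> G) (one : G) (Y : Type) (dY : Y -> Y -> R) (act : G -> Y -> Y).
Hypotheses (p1 : 1 <= p) (c0 : 0 < c) (grp : is_group mul inv one)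
  (dYm : is_metric dY) (dYc : complete_metric dY) (dYg : geodesic_space dY)
  (dYu : p_uniformly_convex p c dY) (actP : isometric_action mul one dY act).
Variable f : G -> Y.
Hypothesis fE : equivariant mul act f.

Lemma p_cost_pushforward (eta : walk R G) x y :
  p_cost p dY (Defs.pushforward mul eta f x) y =
  transition mul eta (fun b => dY (f b) y `^ p) x.
Proof. by rewrite /p_cost /Defs.pushforward big_map. Qed.

(** The epsilon in [c_p] returns a true minimizer because one exists. *)
Lemma averagingP (eta : walk R G) x : nonneg_walk eta -> mass eta = 1 ->
  is_p_barycenter p dY (Defs.pushforward mul eta f x) (averaging p mul dY eta f x).
Proof.
move=> eta0 eta1; apply: ClassicalEpsilon.epsilon_spec.
apply: (p_barycenter_exists p1 c0 dYm dYc dYg dYu); last exact: (inhabits (f x)).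
  by move=> a /List.in_map_iff[b [<- /eta0]].
by rewrite /Defs.pushforward big_map.
Qed.

Lemma transition_translate (eta : walk R G) g y :
  transition mul eta (fun b => dY (f b) (act g y) `^ p) g =
  transition mul eta (fun b => dY (f b) y `^ p) one.
Proof.
apply: eq_bigr => a _; case: actP => [_ [_ iso]].
by rewrite (grp_mul1g grp) fE iso.
Qed.

(* By equivariance the minimal cost is the same at every vertex, so summing the
   variational inequality over the neighbours telescopes to mu * eta - eta. *)
Lemma energy_averaging_le (mu eta : walk R G) :
  nonneg_walk mu -> mass mu = 1 -> nonneg_walk eta -> mass eta = 1 ->
  let y := averaging p mul dY eta f one in
  let F := fun b => dY (f b) y `^ p in
  c `^ p * (2 * energy p one dY mu (averaging p mul dY eta f)) <=
  transition mul mu (transition mul eta F) one - transition mul eta F one.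
Proof.
move=> mu0 mu1 eta0 eta1; set y := averaging _ _ _ _ _ _; cbv zeta.
set F := fun b => _.
set V := transition mul eta F one.
rewrite /energy mulVKf ?pnatr_eq0 // mulr_sumr.
have -> : V = \sum_(a <- mu) a.1 * V by rewrite -mulr_suml -/(mass mu) mu1 mul1r.
rewrite -sumrB.
apply: ler_sum_In => a /mu0 a0; rewrite mulrCA -mulrBr ler_wpM2l //.
rewrite (grp_mul1g grp) -/y.
set z := averaging p mul dY eta f a.2.
have s0 : forall b, List.In b (Defs.pushforward mul eta f a.2) -> 0 <= b.1.
  by move=> _ /List.in_map_iff[b [<- /eta0]].
have s1 : \sum_(b <- Defs.pushforward mul eta f a.2) b.1 = 1.
  by rewrite /Defs.pushforward big_map.
have := p_barycenter_variational dYg dYu s0 s1 y (averagingP a.2 eta0 eta1).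
rewrite -/z (met_sym dYm) => H; apply: le_trans H _.
rewrite !p_cost_pushforward lerD2l lerN2.
(* Translating back by [a.2] turns the cost of [z] at the vertex [a.2] into a cost at [one], hence
   at least the minimum [V]. *)
have zE : z = act a.2 (act (inv a.2) z).
  by case: actP => [act1 [actM _]]; rewrite -actM (grp_mulgV grp) act1.
rewrite zE transition_translate /V /F -!p_cost_pushforward.
exact: averagingP.
Qed.

Lemma displacement_equivariant x a : dY (f x) (f (mul x a)) = dY (f one) (f a).
Proof.
case: actP => [_ [_ iso]].
by rewrite -[in LHS](grp_mulg1 grp x) fE -(grp_assoc grp) (grp_mul1g grp) fE iso.
Qed.

Lemma energyE (eta : walk R G) :
  2 * energy p one dY eta f =
  transition mul eta (fun b => dY (f one) (f b) `^ p) one.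
Proof.
rewrite /energy mulVKf ?pnatr_eq0 //.
by apply: eq_bigr => a _; rewrite (grp_mul1g grp).
Qed.

(** * Walks whose atoms all have mass [e], one of them at the identity *)

Section LazyWalk.
Variables (e : R) (mu : walk R G).
Hypotheses (e01 : 0 < e <= 1) (mu_e : forall a, List.In a mu -> a.1 = e)
  (mu1 : mass mu = 1) (mu_lazy : List.In (e, one) mu).

Let e0 : 0 < e. Proof. by case/andP: e01. Qed.
Let p0 : 0 < p. Proof. exact: lt_le_trans ltr01 p1. Qed.
Let mu0 : nonneg_walk mu. Proof. by move=> a /mu_e ->; exact: ltW. Qed.

(** An upper bound for the distance that [f] moves along one step of [mu]: a single atom contributes
    e d^p to twice the energy. *)
Definition max_displacement : R := (2 * energy p one dY mu f / e) `^ p^-1.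
Local Notation L := max_displacement.

Let energy_ge0 : 0 <= 2 * energy p one dY mu f / e.
Proof.
rewrite divr_ge0 ?(ltW e0) // energyE; apply: sumr_ge0_In => a /mu0 a0.
by rewrite mulr_ge0 ?powR_ge0.
Qed.

Lemma max_displacement_ge0 : 0 <= L. Proof. exact: powR_ge0. Qed.

Lemma max_displacement_powR : L `^ p = 2 * energy p one dY mu f / e.
Proof. by rewrite -powRrM mulVf ?gt_eqF // powRr1. Qed.

Lemma displacement_le a x : List.In a mu -> dY (f x) (f (mul x a.2)) <= L.
Proof.
move=> ai; rewrite displacement_equivariant.
set D := dY _ _; have D0 : 0 <= D by rewrite (met_ge0 dYm).
have -> : D = (D `^ p) `^ p^-1 by rewrite -powRrM mulfV ?gt_eqF // powRr1.
apply: ler_powRl; rewrite ?invr_ge0 ?powR_ge0 ?(ltW p0) //.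
rewrite ler_pdivlMr // /energy mulVKf ?pnatr_eq0 // mulrC -(mu_e ai).
apply: (@ler_term_sum_In _ _ _ (fun a => a.1 * dY (f one) (f a.2) `^ p)) => //.
by move=> b /mu0 b0; rewrite mulr_ge0 ?powR_ge0.
Qed.

Let dist0 x : dY (f x) (f x) = 0. Proof. exact/(met_eq0 dYm). Qed.

Lemma energy_pow_le n :
  2 * energy p one dY (wpow mul one mu n) f <= (n%:R * L) `^ p.
Proof.
rewrite energyE (transition_pow (grp_assoc grp) (grp_mulg1 grp)).
have := @iter_transition_le R G mul (fun x y => dY (f x) (f y)) L
  ((n%:R * L) `^ p) mu n (fun b => dY (f one) (f b) `^ p) one.
rewrite mu1 expr1n mul1r; apply=> //; rewrite ?powR_ge0 //.
- by move=> x y z; exact: (met_tri dYm).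
- by move=> a x; exact: displacement_le.
- by move=> y dy; apply: ler_powRl; rewrite ?(ltW p0) ?(met_ge0 dYm).
Qed.

Section Iterate.
Variable n : nat.
Let eta := wpow mul one mu n.
Let y := averaging p mul dY eta f one.
Let F b := dY (f b) y `^ p.
Let eta0 : nonneg_walk eta. Proof. exact: nonneg_pow. Qed.
Let eta1 : mass eta = 1. Proof. by rewrite mass_pow mu1 expr1n. Qed.

(** The point [f one] competes in the minimization, and its cost is twice the energy. *)
Lemma averaging_cost_le : transition mul eta F one <= 2 * energy p one dY eta f.
Proof.
rewrite energyE -p_cost_pushforward; apply: le_trans (averagingP one eta0 eta1 (f one)) _.
rewrite p_cost_pushforward; apply: le_transition => // b.
by rewrite (met_sym dYm).
Qed.

(** Average over b the triangle inequality through f b; each of the two resulting sums is at most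
    twice the energy. *)
Lemma dist_averaging_le : dY (f one) y `^ p <= 2 `^ p * (4 * energy p one dY eta f).
Proof.
rewrite -[leLHS]mul1r -[X in X * _]eta1 -(transition_cst mul eta _ one).
apply: (@le_trans _ _ (transition mul eta
  (fun b => 2 `^ p * (dY (f one) (f b) `^ p + F b)) one)).
  apply: le_transition => // b.
  apply: le_trans (powR_addr_le (ltW p0) (met_ge0 dYm _ _) (met_ge0 dYm _ _)).
  by apply: ler_powRl; rewrite ?(ltW p0) ?(met_ge0 dYm) // (met_tri dYm).
have -> : transition mul eta (fun b => 2 `^ p * (dY (f one) (f b) `^ p + F b)) one
  = 2 `^ p * (2 * energy p one dY eta f + transition mul eta F one).
  rewrite energyE /transition -big_split mulr_sumr; apply: eq_bigr => a _ /=.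
  by rewrite mulrCA mulrDr.
rewrite ler_wpM2l ?powR_ge0 //.
by have := averaging_cost_le; lra.
Qed.

Lemma energy_averaging_tail_le (dl : R) : 0 <= dl ->
  c `^ p * (2 * energy p one dY mu (averaging p mul dY eta f)) <=
  dl * (2 * energy p one dY eta f) +
  binomial_lower_tail e n.+1 (n.+1%:R * e / (1 + dl)) *
    (2 `^ p * ((n.+1%:R * L) `^ p + dY (f one) y `^ p)).
Proof.
move=> dl0.
apply: le_trans (energy_averaging_le mu0 mu1 eta0 eta1) _.
rewrite -/y -/F.
have dl_cost := ler_wpM2l dl0 averaging_cost_le.
suff : transition mul mu (transition mul eta F) one <=
  (1 + dl) * transition mul eta F one +
  binomial_lower_tail e n.+1 (n.+1%:R * e / (1 + dl)) *
    (2 `^ p * ((n.+1%:R * L) `^ p + dY (f one) y `^ p)) by lra.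
rewrite (transition_pow (grp_assoc grp) (grp_mulg1 grp)) -iterS.
(* Removing the lazy atom leaves [nu], of mass 1 - e, whose steps still have length at most [L]. *)
have [nu1 [nu2 muE]] := List.in_split _ _ mu_lazy.
have {}muE : mu = nu1 ++ (e, one) :: nu2 := muE.
set nu := nu1 ++ nu2.
have nu_mu a : List.In a nu -> List.In a mu.
  rewrite muE => /List.in_app_iff[ai|ai]; apply/List.in_app_iff; first by left.
  by right; right.
have nu0 : nonneg_walk nu by move=> a /nu_mu; exact: mu0.
have numass : mass nu = 1 - e.
  rewrite -mu1 muE /mass /nu !big_cat big_cons /=; ring.
rewrite [in X in X <= _]muE [in X in _ * X]muE.
rewrite !(iter_transition_lazy (grp_mulg1 grp)) -/nu.
apply: (binomial_step (c := fun k => iter k (transition mul nu) F one)) => //.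
  by move=> k; apply: iter_transition_ge0 => // b; rewrite powR_ge0.
move=> k kn; rewrite -numass.
apply: (iter_transition_le (dist := fun x y => dY (f x) (f y)) (L := L)) => //.
- by move=> x1 x2 x3; exact: (met_tri dYm).
- by move=> a x /nu_mu; exact: displacement_le.
- by rewrite mulr_ge0 ?addr_ge0 ?powR_ge0.
move=> b db.
apply: (@le_trans _ _ ((dY (f one) (f b) + dY (f one) y) `^ p)).
  apply: ler_powRl; rewrite ?(ltW p0) ?(met_ge0 dYm) //.
  by rewrite (met_sym dYm (f one) (f b)) (met_tri dYm).
apply: le_trans (powR_addr_le (ltW p0) (met_ge0 dYm _ _) (met_ge0 dYm _ _)) _.
rewrite ler_wpM2l ?powR_ge0 // lerD2r.
apply: ler_powRl; rewrite ?(ltW p0) ?(met_ge0 dYm) //.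
by apply: le_trans db _; rewrite ler_wpM2r ?max_displacement_ge0 // ler_nat.
Qed.
End Iterate.

(** Take dl = K sqrt (ln n / n) in the previous bound. The tail absorbs the growth (n + 1)^p <= (n +
    1)^q and leaves one spare factor, which becomes 1/n. *)
Lemma energy_averaging_lazy_le (q : nat) (K C : R) (n : nat) : p <= q%:R ->
  0 <= K -> 0 <= C -> (1 <= n)%N ->
  binomial_lower_tail e n.+1
    (n.+1%:R * e / (1 + K * Num.sqrt (ln n%:R / n%:R))) * n.+1%:R ^+ q.+1 <= C ->
  energy p one dY mu (averaging p mul dY (wpow mul one mu n) f) <=
  (K / c `^ p + 2 `^ p * (1 + 2 `^ p * 2) * C / e / c `^ p) *
  (Num.sqrt (ln n%:R / n%:R) * energy p one dY (wpow mul one mu n) f +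
   n%:R^-1 * energy p one dY mu f).
Proof.
move=> pq K0 C0 n1; set s := Num.sqrt _; set P := binomial_lower_tail _ _ _ => PC.
have s0 : 0 <= s by rewrite sqrtr_ge0.
have := energy_averaging_tail_le n (mulr_ge0 K0 s0).
have := dist_averaging_le n; have := energy_pow_le n.
set D0 := dY _ _ `^ p; set EA := energy _ _ _ mu (averaging _ _ _ _ _).
set En := energy _ _ _ (wpow _ _ _ _) _.
rewrite -/P powRM ?max_displacement_ge0 // powRM ?max_displacement_ge0 //.
rewrite max_displacement_powR.
set E1 := energy p one dY mu f.
move=> H1 H2 H3.
have e00 := ltW e0.
have u0 : 0 <= 2 * E1 / e by exact: energy_ge0.
have E10 : 0 <= E1.
  by move: u0; rewrite ler_pdivlMr // mul0r pmulr_rge0.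
have En0 : 0 <= En.
  rewrite -(pmulr_rge0 _ (ltr0Sn R 1)) energyE; apply: sumr_ge0_In => a ai.
  by rewrite mulr_ge0 ?powR_ge0 //; exact: nonneg_pow ai.
have k0 : 0 < c `^ p by rewrite powR_gt0.
have B0 : 0 <= 2 `^ p :> R := powR_ge0 _ _.
have n0 : 0 < n%:R :> R by rewrite ltr0n.
have P0 : 0 <= P.
  apply: sumr_ge0 => k _; rewrite !mulr_ge0 ?exprn_ge0 // subr_ge0.
  by case/andP: e01.
have NW : n.+1%:R `^ p <= n.+1%:R ^+ q :> R.
  by rewrite -powR_mulrn //; apply: ler_powR; rewrite ?ler1n.
have nN : n%:R `^ p <= n.+1%:R `^ p :> R.
  by apply: ler_powRl; rewrite ?(ltW p0) // ler_nat.
have PW : P * n.+1%:R ^+ q <= C / n%:R.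
  rewrite ler_pdivlMr //; apply: le_trans PC; rewrite exprSr mulrA.
  by rewrite ler_wpM2l ?mulr_ge0 ?exprn_ge0 // ler_nat.
move: H1 H2 H3 NW nN PW u0; set W := n.+1%:R ^+ q; set v := 2 * E1 / e.
set B := 2 `^ p in B0 *; set Np := n.+1%:R `^ p; set np := n%:R `^ p.
move=> H1 H2 H3 NW nN PW v0.
have B20 : 0 <= 1 + B * 2 by rewrite addr_ge0 // mulr_ge0.
(* [D0] is at most 2 B times twice the energy of mu^n, which is itself at most n^p L^p <= W v. *)
have M1 : Np * v + D0 <= (1 + B * 2) * (W * v).
  have h1 : Np * v <= W * v by rewrite ler_wpM2r.
  have h2 : 2 * En <= W * v.
    by apply: le_trans H1 _; rewrite ler_wpM2r // (le_trans nN).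
  have := ler_wpM2l B0 h2; lra.
have M2 : P * (B * (Np * v + D0)) <= B * (1 + B * 2) * v * (C / n%:R).
  apply: (@le_trans _ _ (B * (1 + B * 2) * v * (P * W))).
    have := ler_wpM2l (mulr_ge0 P0 B0) M1; lra.
  by apply: ler_wpM2l PW; apply: mulr_ge0 v0; apply: mulr_ge0.
have H := le_trans H3 (lerD (lexx _) M2).
rewrite -(ler_pM2l (mulr_gt0 (ltr0Sn R 1) k0)).
set A1 := K / c `^ p; set A2 := _ / c `^ p.
have A10 : 0 <= A1 by rewrite divr_ge0 // ltW.
have A20 : 0 <= A2.
  do 2!(apply: divr_ge0; last by rewrite // ltW).
  by apply: mulr_ge0 C0; apply: mulr_ge0.
have sE : 0 <= s * En by rewrite mulr_ge0.
have nE : 0 <= n%:R^-1 * E1 by rewrite mulr_ge0 // invr_ge0 ltW.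
apply: (@le_trans _ _ (2 * c `^ p * (A1 * (s * En) + A2 * (n%:R^-1 * E1)))).
  rewrite -[leLHS]mulrA [leLHS]mulrCA; apply: le_trans H _.
  rewrite le_eqVlt; apply/orP; left; apply/eqP; rewrite /A1 /A2 /v.
  by field; rewrite !gt_eqF.
rewrite ler_wpM2l ?mulr_ge0 ?(ltW k0) // mulrDl.
by apply: lerD; [rewrite ler_wpM2l // lerDl | rewrite ler_wpM2l // lerDr].
Qed.
End LazyWalk.
End EquivariantAveraging.

(** * The standard walk, and the final bound *)

Lemma wconv_nil (R : realType) (G : Type) (mul : G -> G -> G) (eta : walk R G) :
  wconv mul eta [::] = [::].
Proof. by rewrite /wconv; elim: eta. Qed.

Lemma mass_std_walk (R : realType) (G : Type) (d : nat) (S : seq G) :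
  (0 < d)%N -> size S = (2 * d)%N -> mass (std_walk R d S) = 1.
Proof.
move=> d0 sizeS; rewrite /mass /std_walk big_map /= big_const_seq count_predT.
rewrite sizeS iter_addr_0 -[LHS]mulr_natr mulVf // pnatr_eq0 muln_eq0.
by rewrite -lt0n d0.
Qed.

Theorem theorem3p10 (R : realType) (p cY : R) (d j : nat) :
  2 <= p -> 0 < cY -> (0 < j)%N -> ~~ odd j ->
  exists C : R,
  forall (G : Type) (mul : G -> G -> G) (inv : G -> G) (one : G) (S : seq G)
         (Y : Type) (dY : Y -> Y -> R) (act : G -> Y -> Y),
    is_group mul inv one ->
    List.NoDup S -> size S = (2 * d)%N ->
    symmetric_set inv S -> ~ List.In one S -> generates mul one S ->
    is_metric dY -> complete_metric dY -> geodesic_space dY ->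
    p_uniformly_convex p cY dY ->
    isometric_action mul one dY act ->
    let mu := wpow mul one (std_walk R d S) j in
    forall f : G -> Y, equivariant mul act f ->
    forall n : nat, (1 <= n)%N ->
      energy p one dY mu (averaging p mul dY (wpow mul one mu n) f)
      <= C * (Num.sqrt (ln n%:R / n%:R) * energy p one dY (wpow mul one mu n) f
              + n%:R^-1 * energy p one dY mu f).
Proof.
move=> p2 c0 j0 jeven.
have p1 : 1 <= p by lra.
have [d0|d0] := leqP d 0.
  (* For d = 0 the set [S] is empty and, as j > 0, so is [mu]: the left side vanishes. *)
  exists 0 => G mul inv one S Y dY act _ _.
  move: d0; rewrite leqn0 => /eqP -> /size0nil -> _ _ _ _ _ _ _ _ mu f _ n _.
  have -> : mu = [::].
    by rewrite /mu; case: (j) j0 => // i _; exact: wconv_nil.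
  by rewrite mul0r /energy big_nil mulr0.
(* Atoms of [mu] are words of length [j], kept unmerged, so each weighs exactly [e]. The constants
   [K] and [C] below depend only on [e] and p, hence on p, d and j. *)
pose e : R := (2 * d)%:R^-1 ^+ j.
have dR : 0 < (2 * d)%:R :> R by rewrite ltr0n muln_gt0.
have e01 : 0 < e <= 1.
  rewrite exprn_gt0 ?invr_gt0 //= exprn_ile1 ?invr_ge0 ?(ltW dR) //.
  by rewrite invf_le1 // ler1n muln_gt0.
pose q := Num.bound p.
have p0 : 0 <= p := le_trans ler01 p1.
have pq : p <= q%:R by exact/ltW/archi_boundP.
have [K [C [K0 C0 tail]]] := binomial_lower_tail_poly q e01.
exists (K / cY `^ p + 2 `^ p * (1 + 2 `^ p * 2) * C / e / cY `^ p).
move=> G mul inv one S Y dY act grp _ sizeS Ssym _ _ dYm dYc dYg dYu actP mu f fE n n1.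
have mulA := grp_assoc grp; have mulg1 := grp_mulg1 grp.
have stdw a : List.In a (std_walk R d S) -> a.1 = (2 * d)%:R^-1.
  by move=> /List.in_map_iff[s [<- _]].
apply: (energy_averaging_lazy_le p1 c0 grp dYm dYc dYg dYu actP fE e01 _ _ _ pq K0 C0 n1).
- exact: pow_const_weight.
- by rewrite /mu mass_pow mass_std_walk // expr1n.
(* As d > 0, [S] has an element [s]; alternating [s] with its inverse returns to [one] after [j]
   steps. *)
- case: S sizeS Ssym @mu stdw => [|s S] sizeS Ssym mu stdw.
    by move: d0; rewrite -(ltn_pmul2l (_ : 0 < 2)%N) // -sizeS.
  rewrite /mu /e -(even_halfK jeven).
  apply: (@in_pow_double _ _ _ _ mulA mulg1 _ _ s (inv s)).
  + by left.
  + by apply: (List.in_map (fun t => ((2 * d)%:R^-1 : R, t)) (s :: S)); apply: Ssym; left.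
  + exact: (grp_mulgV grp).
- exact: (tail n n1).
Qed.
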